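(* Consider an MM algorithm for minimizing a function $f$ on $\mathbb{R}^p$ with surrogates $g(\cdot\mid\boldsymbol{z})$ majorizing $f$ at the anchor $\boldsymbol{z}$. Suppose that $f$ is coercive, that the surrogates $g(\cdot\mid\boldsymbol{z})$ are differentiable, and that the (set-valued) algorithm map $M(\boldsymbol{z})=\operatorname{argmin}_{\boldsymbol{x}} g(\boldsymbol{x}\mid\boldsymbol{z})$ is closed. Let $\{\boldsymbol{x}_n\}$ be an MM sequence, $\boldsymbol{x}_{n+1}\in M(\boldsymbol{x}_n)$, and let $W$ be its set of limit points. Then every $\boldsymbol{z}\in W$ is critical in the sense that $\boldsymbol{0}\in\partial^F(-f)(\boldsymbol{z})$.
   Context: Functions take values in $\mathbb{R}\cup\{\infty\}$. $g(\cdot\mid\boldsymbol{z})$ majorizes $f$ at $\boldsymbol{z}$ if $g(\boldsymbol{z}\mid\boldsymbol{z})=f(\boldsymbol{z})$ and $f(\boldsymbol{x})\le g(\boldsymbol{x}\mid\boldsymbol{z})$ for all $\boldsymbol{x}$. A set-valued map $M$ is closed if, at each point $\boldsymbol{x}$, whenever $\boldsymbol{u}_n\to\boldsymbol{x}$, $\boldsymbol{v}_n\in M(\boldsymbol{u}_n)$ and $\boldsymbol{v}_n\to\boldsymbol{v}$, one has $\boldsymbol{v}\in M(\boldsymbol{x})$. A limit point of a sequence is the limit of some convergent subsequence. The Fréchet subdifferential of a function $h$ at a point $\boldsymbol{x}$ where $h$ is finite is $$\partial^F h(\boldsymbol{x})=\Big\{\boldsymbol{v}:\liminf_{\boldsymbol{y}\to\boldsymbol{x}}\frac{h(\boldsymbol{y})-h(\boldsymbol{x})-\langle\boldsymbol{v},\boldsymbol{y}-\boldsymbol{x}\rangle}{\|\boldsymbol{y}-\boldsymbol{x}\|}\ge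 0\Big\}.$$
   Formalization: ''Coercive'' is taken to mean that all sublevel sets of f are compact, i.e. f tends to infinity at infinity and is lower semicontinuous; with growth at infinity alone the claim fails. *)

(* Defs.v *)
From HB Require Import structures.
From mathcomp Require Import all_boot all_order all_algebra.
From mathcomp Require Import all_classical all_reals all_analysis.

Set Implicit Arguments.
Unset Strict Implicit.
Unset Printing Implicit Defensive.

Import Order.TTheory GRing.Theory Num.Theory.
Import numFieldNormedType.Exports.

Local Open Scope classical_set_scope.
Local Open Scope ring_scope.

(* The library norm on row vectors is the sup norm, hence these two. *)
Definition dot (R : realType) (p : nat) (u v : 'rV[R]_p) : R :=
  \sum_(i < p) u 0 i * v 0 i.

Definition enorm (R : realType) (p : nat) (v : 'rV[R]_p) : R :=
  Num.sqrt (dot v v).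

Definition nowhere_ninfty (R : realType) (T : Type) (h : T -> \bar R) : Prop :=
  forall x, h x != -oo%E.

(* Here [g x z] stands for g(x | z): the anchor z is the second argument. *)
Definition majorizes (R : realType) (T : Type)
    (g : T -> T -> \bar R) (f : T -> \bar R) (z : T) : Prop :=
  g z z = f z /\ forall x, (f x <= g x z)%E.

(* Coercivity is compactness of the sublevel sets. For functions on R^p
   that never take the value -oo, this amounts to h(x) --> +oo as
   |x| --> +oo together with lower semicontinuity of h. *)
Definition coercive (R : realType) (p : nat) (h : 'rV[R]_p -> \bar R) : Prop :=
  forall c : R, compact [set x | (h x <= c%:E)%E].

Definition ereal_differentiable (R : realType) (p : nat)
    (h : 'rV[R]_p -> \bar R) (x : 'rV[R]_p) : Prop :=
  (\forall y \near x, h y \is a fin_num) /\ differentiable (fine \o h) x.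

Definition argmin (R : realType) (T : Type) (h : T -> \bar R) : set T :=
  [set x | forall y, (h x <= h y)%E].

Definition MM_map (R : realType) (T : Type) (g : T -> T -> \bar R) (z : T) :
    set T :=
  argmin (fun x => g x z).

Definition closed_map (T : topologicalType) (M : T -> set T) : Prop :=
  forall (x v : T) (u_ v_ : nat -> T),
    u_ @ \oo --> x -> (forall n, M (u_ n) (v_ n)) -> v_ @ \oo --> v -> M x v.

Definition limit_points (T : topologicalType) (x_ : nat -> T) : set T :=
  [set z | exists phi : nat -> nat,
     {homo phi : m n / (m < n)%N} /\ (x_ \o phi) @ \oo --> z].

(* Empty at the points where h is not finite. *)
Definition frechet_subdifferential (R : realType) (p : nat)
    (h : 'rV[R]_p -> \bar R) (x : 'rV[R]_p) : set 'rV[R]_p :=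
  [set v | h x \is a fin_num /\
     (0 <= limf_einf
             (fun y => (h y - h x - (dot v (y - x))%:E)
                       * ((enorm (y - x))^-1)%:E)
             x^')%E].

(* Main.v *)
(* Majorization by differentiable surrogates makes f upper semicontinuous, and
   coercivity makes it lower semicontinuous.  If x_(phi n) --> z, then by
   compactness the successors x_(phi n).+1 accumulate at some v, with v \in M z
   by closedness of M.  Along the whole sequence f(x_n) is nonincreasing, so
   continuity of f forces f z <= f v <= g(v | z), i.e. z itself minimizes
   g(. | z).  The first-order expansion of g(. | z) at its minimizer z then
   gives f y <= g(y | z) <= f z + o(|y - z|). *)
Require Import Defs.
From HB Require Import structures.
From mathcomp Require Import all_boot all_order all_algebra.
From mathcomp Require Import all_classical all_reals all_analysis.
From mathcomp Require Import lra.
Import Order.TTheory GRing.Theory Num.Theory.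
Import numFieldNormedType.Exports.
Local Open Scope classical_set_scope.
Local Open Scope ring_scope.

(** Differentiability controls remainders in the sup norm, whereas the subdifferential quotient
    divides by [enorm]. A coordinate attaining the sup norm contributes its square to [dot v v]. *)
Lemma mx_norm_le_enorm (R : realType) (p : nat) (v : 'rV[R]_p) :
  `|v| <= enorm v.
Proof.
have [->|v0] := eqVneq v 0; first by rewrite normr0 sqrtr_ge0.
have [[k i] vE] : exists i, `|v| = `|v i.1 i.2|.
  by apply: mx_norm_neq0; rewrite -[mx_norm v]/(`|v|) normr_eq0.
rewrite vE /= (ord1 k) -sqrtr_sqr ler_wsqrtr// /dot (bigD1 i)//= expr2 lerDl.
by apply: sumr_ge0 => j _; rewrite -expr2 sqr_ge0.
Qed.

Lemma differentiable_min_le (R : realType) (V : normedModType R) (h : V -> R)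
    (z : V) :
  differentiable h z -> (forall y, h z <= h y) ->
  forall e, 0 < e -> \forall y \near z, h y - h z <= e * `|y - z|.
Proof.
(* One half of [e] pays for the remainder at [y], the other for the linear term. *)
move=> dh hmin e e0; have e20 : 0 < e / 2 by rewrite divr_gt0.
have /eqaddoP/(_ _ e20)/nbhs_normP[d d0 hd] := diff_locally dh.
apply/nbhs_normP; exists d => // y /= yz.
(* The expansion at the reflected point bounds the linear term by o(|y - z|). *)
have yz' : `|y - z| < d by rewrite distrC.
have := hd (z - y); have := hd (y - z).
rewrite /ball_ /= !sub0r !normrN (distrC z y) => /(_ yz') + /(_ yz').
rewrite -[(h \o shift z - (cst (h z) + 'd h z)) (y - z)]/
  (h (y - z + z) - (h z + 'd h z (y - z))).
rewrite -[(h \o shift z - (cst (h z) + 'd h z)) (z - y)]/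
  (h (z - y + z) - (h z + 'd h z (z - y))).
rewrite subrK -(opprB y z) linearN !ler_norml.
move: (hmin (- (y - z) + z)) => + /andP[_ +] /andP[_ +]; lra.
Qed.

(** A cluster point [v] has terms of arbitrarily large index within [1/(n+1)] of it. The choice
    [psi] need not be monotone: [n <= psi n] already sends it to infinity. *)
Lemma compact_seq_subsequence (R : realType) (V : normedModType R)
    (K : set V) (u : nat -> V) :
  compact K -> (forall n, K (u n)) ->
  exists (v : V) (psi : nat -> nat),
    (forall n, (n <= psi n)%N) /\ (u \o psi) @ \oo --> v.
Proof.
move=> cK uK.
have [|v [_ clv]] := cK (u @ \oo) _; first by exists 0%N => // n _; exact: uK.
have /choice[psi psiP] n : exists m, (n <= m)%N /\ `|v - u m| < n.+1%:R^-1.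
  have [||w [[m nm <-]]] := clv (u @` [set m | (n <= m)%N])
      (ball v n.+1%:R^-1).
  - by exists n => // m nm; exists m.
  - by apply: nbhsx_ballx; rewrite invr_gt0.
  - by rewrite -ball_normE => ?; exists m.
exists v, psi; split=> [n|]; first by case: (psiP n).
apply/cvgrPdist_lt => e e0; near=> n.
have [_ /lt_trans->//] := psiP n.
by near: n; exact: near_infty_natSinv_lt (PosNum e0).
Unshelve. all: by end_near. Qed.

Section MM.
Context {R : realType} {p : nat}.
Variables (f : 'rV[R]_p -> \bar R) (g : 'rV[R]_p -> 'rV[R]_p -> \bar R).
Hypothesis g_major : forall z, majorizes g f z.
Hypothesis g_diff : forall z x, ereal_differentiable (fun y => g y z) x.

Lemma surrogate_fin_num y z : g y z \is a fin_num.
Proof. by have [/nbhs_singleton] := g_diff z y. Qed.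

Lemma objective_fin_num z : f z \is a fin_num.
Proof. by have [<- _] := g_major z; exact: surrogate_fin_num. Qed.

(** The surrogate anchored at [v] is continuous, dominates [f] and touches it at [v]. *)
Lemma objective_usc v (c : R) : (f v < c%:E)%E ->
  \forall y \near v, (f y < c%:E)%E.
Proof.
move=> fvc; have [_ /differentiable_continuous gc] := g_diff v v.
have : (fine \o g^~ v) v < c.
  by rewrite -lte_fin /= fineK ?surrogate_fin_num// (g_major v).1.
move=> /(cvgr_lt _ gc); apply: filterS => y gyc.
apply: le_lt_trans ((g_major v).2 y) _.
by rewrite -[g y v]fineK ?surrogate_fin_num// lte_fin.
Qed.

Lemma MM_descent x_ : (forall n, MM_map g (x_ n) (x_ n.+1)) ->
  forall m n, (m <= n)%N -> (f (x_ n) <= f (x_ m))%E.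
Proof.
move=> x_MM m n /subnK <-; elim: (n - m)%N => [|k IH] //.
apply: le_trans IH; rewrite addSn.
apply: le_trans ((g_major (x_ (k + m)%N)).2 _) _.
by rewrite -(g_major (x_ (k + m)%N)).1; exact: x_MM.
Qed.

Lemma argmin_frechet z : MM_map g z z ->
  frechet_subdifferential (fun x => (- f x)%E) z 0.
Proof.
move=> zM; split; first by rewrite fin_numN objective_fin_num.
apply/lee_subgt0Pr => e e0; rewrite sub0e limf_einfE.
have [_ dg] := g_diff z z.
have gmin y : (fine \o g^~ z) z <= (fine \o g^~ z) y.
  by apply: fine_le (zM y); exact: surrogate_fin_num.
have nz := differentiable_min_le _ _ _ _ dg gmin _ e0.
(* The lower limit is a supremum of infima, so one punctured neighbourhood on which the quotient is
   at least [- e] suffices. *)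
apply: (le_trans _ (ereal_sup_ubound _)); last first.
  exists [set y | y != z /\
    (fine \o g^~ z) y - (fine \o g^~ z) z <= e * `|y - z|] => //.
  near=> y; split; first by near: y; exact: nbhs_dnbhs_neq.
  by near: y; exact: cvg_within nz.
apply: le_ereal_inf_tmp => _ [y /= [yz gyz] <-].
have d0 : dot 0 (y - z) = 0 by rewrite /dot big1// => i _; rewrite mxE mul0r.
rewrite d0 oppeK sube0 -(fineK (objective_fin_num y)).
rewrite -(fineK (objective_fin_num z)) -EFinN -EFinD -EFinM lee_fin.
have nyz : 0 < `|y - z| by rewrite normr_gt0 subr_eq0.
have yzE := mx_norm_le_enorm _ _ (y - z).
rewrite ler_pdivlMr ?(lt_le_trans nyz)// mulNr lerNl opprD opprK.
apply: (le_trans _ (ler_wpM2l (ltW e0) yzE)); apply: le_trans gyz.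
rewrite (g_major z).1 lerB//; apply: fine_le ((g_major z).2 y).
- exact: objective_fin_num.
- exact: surrogate_fin_num.
Unshelve. all: by end_near. Qed.

Lemma limit_point_argmin (f_coercive : coercive f)
    (M_closed : closed_map (MM_map g)) (x_ : nat -> 'rV[R]_p)
    (x_MM : forall n, MM_map g (x_ n) (x_ n.+1)) z :
  limit_points x_ z -> MM_map g z z.
Proof.
move=> [phi [phi_mono xz]]; have desc := MM_descent _ x_MM.
have phi_ge n : (n <= phi n)%N.
  by elim: n => // n IH; exact: leq_ltn_trans IH (phi_mono _ _ (ltnSn n)).
(* Descent keeps every iterate in the compact sublevel set of [f] at its starting value. *)
have [n|v [psi [psi_ge xv]]] :=
  compact_seq_subsequence _ _ _ (x_ \o S \o phi) (f_coercive (fine (f (x_ 0%N)))).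
  by rewrite /= fineK ?objective_fin_num//; exact: desc.
have psi_oo : psi @ \oo --> \oo.
  by apply: (cvgnyPge _).2 => A; exists A => // n /= /leq_trans; exact.
have vM : MM_map g z v.
  apply: M_closed (cvg_comp _ _ psi_oo xz) _ xv => n; exact: x_MM.
suff fzv : (f z <= f v)%E.
  move=> y; rewrite (g_major z).1; apply: le_trans fzv _.
  exact: le_trans ((g_major z).2 v) (vM y).
rewrite leNgt; apply/negP => fvz.
(* Some successor near [v] falls below the level [c]. Descent keeps all later iterates there, and
   the closed sublevel set then captures [z], contradicting [c < f z]. *)
have [c /andP[fvc cfz]] : exists c : R, ((f v < c%:E) && (c%:E < f z))%E.
  move: fvz; rewrite -(fineK (objective_fin_num v)) -(fineK (objective_fin_num z)).
  rewrite lte_fin => /midf_lt[? ?]; exists ((fine (f v) + fine (f z)) / 2).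
  by rewrite !lte_fin; apply/andP.
have [N _ /(_ N (leqnn N)) /= fNc] := xv _ (objective_usc _ _ fvc).
have : (f z <= c%:E)%E.
  apply: (closed_cvg [set x | (f x <= c%:E)%E] _ _ _ xz).
    by apply: compact_closed (f_coercive c); exact: norm_hausdorff.
  exists (phi (psi N)).+1 => // n /= Nn.
  exact: le_trans (desc _ _ (leq_trans Nn (phi_ge n))) (ltW fNc).
by rewrite leNgt cfz.
Qed.

End MM.

Theorem proposition2p11 (R : realType) (p : nat)
    (f : 'rV[R]_p -> \bar R) (g : 'rV[R]_p -> 'rV[R]_p -> \bar R)
    (f_ninfty : nowhere_ninfty f)
    (g_ninfty : forall z, nowhere_ninfty (fun x => g x z))
    (g_major : forall z, majorizes g f z)
    (f_coercive : coercive f)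
    (g_diff : forall z x, ereal_differentiable (fun y => g y z) x)
    (M_closed : closed_map (MM_map g))
    (x_ : nat -> 'rV[R]_p)
    (x_MM : forall n, MM_map g (x_ n) (x_ n.+1)) :
  forall z, limit_points x_ z ->
    frechet_subdifferential (fun x => (- f x)%E) z 0.
Proof.
move=> z /(limit_point_argmin _ _ g_major g_diff f_coercive M_closed _ x_MM).
exact: argmin_frechet.
Qed.
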